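(* Let $0<q<1$ and let $u,v\in\mathbb{C}$. Then the identity $$e_q(z,u)\,e_q(-z,v)=1$$ holds (as an identity of formal power series in $z$) if and only if $(u,v)\in\{(1,q),(q,1)\}$.
   Context: For $0<q<1$, the $q$-shifted factorial is $(q;q)_0=1$ and $(q;q)_n=\prod_{k=1}^{n}(1-q^k)$ for $n\ge 1$. For $u\in\mathbb{C}$, the deformed $q$-exponential is the power series $$e_q(z,u)=\sum_{n=0}^{\infty}u^{\binom{n}{2}}\frac{z^n}{(q;q)_n},$$ where $\binom{0}{2}=\binom{1}{2}=0$ and $u^0=1$ for all $u$ (including $u=0$). Correspondingly $e_q(-z,v)=\sum_{n\ge0}v^{\binom n2}\frac{(-z)^n}{(q;q)_n}$. Products are Cauchy products of power series in $z$. *)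

(* Defs.v *)
From mathcomp Require Import all_boot all_order all_algebra.
From mathcomp Require Import complex reals.

Set Implicit Arguments.
Unset Strict Implicit.
Unset Printing Implicit Defensive.

Import GRing.Theory.
Local Open Scope ring_scope.

(* A formal power series \sum_n f_n z^n is its coefficient sequence f;
   equality of series is equality of all coefficients, f =1 g. *)
Definition fps (A : Type) : Type := nat -> A.

Definition fps_one (A : pzRingType) : fps A := fun n => (n == 0%N)%:R.

Definition fps_mul (A : pzRingType) (f g : fps A) : fps A :=
  fun n => \sum_(k < n.+1) f k * g (n - k)%N.

(* f(- z) *)
Definition fps_neg_var (A : pzRingType) (f : fps A) : fps A :=
  fun n => (-1) ^+ n * f n.

(* (q; q)_n *)
Definition qfact (F : pzRingType) (q : F) (n : nat) : F :=
  \prod_(1 <= k < n.+1) (1 - q ^+ k).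

(* e_q(z, u) as a series in z; note that 0 ^+ 0 = 1. *)
Definition deformed_qexp (F : fieldType) (q u : F) : fps F :=
  fun n => u ^+ 'C(n, 2) / qfact q n.

(* Main.v *)
Require Import Defs.
From mathcomp Require Import all_boot all_order all_algebra.
From mathcomp Require Import complex reals.
From mathcomp Require Import ring.

(** Write [c_n] for the coefficients of [e_q(z,u) e_q(-z,v)].

    For the pair [(1, q)] this is Euler's identity.  The ratio of consecutive
    coefficients of [e_q(z,u)] is [u^n / (1 - q^(n+1))]; weighting the Cauchy
    product by [1 - q^n = (1 - q^k) + q^k (1 - q^(n-k))] turns these two ratios
    into [(1 - q^(n+1)) c_(n+1) = (1 - q^n) c_n].  Hence [(1 - q^n) c_n] is
    constant, equal to its value [0] at [n = 0], and [c_n = 0] for [n > 0].  The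
    pair [(q, 1)] follows through [z |-> - z], which exchanges the two factors.

    Conversely, the coefficients of degree at most 4 already determine [(u, v)].
    Degree 2 says [u + v = 1 + q].  Degree 3 says
    [(u - v) (u^2 + u v + v^2 - (1 + q + q^2)) = 0]; given the sum, the second
    factor vanishes exactly when [u v = q], so that [u] and [v] are the roots
    [1] and [q] of [(t - 1) (t - q)].  The remaining case [u = v = (1 + q) / 2]
    satisfies all odd degrees, but there the degree 4 coefficient is, up to
    nonzero factors, [(1 - q)^4]. *)

Set Implicit Arguments.
Unset Strict Implicit.
Unset Printing Implicit Defensive.

Import Order.TTheory GRing.Theory Num.Theory.
Local Open Scope ring_scope.
Local Open Scope complex_scope.

(** Substituting [- z] for [z] in [f(z) g(- z)] exchanges the roles of [f] and
    [g], and multiplies the coefficient of degree [n] by [(-1)^n]. *)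
Lemma fps_mul_neg_varC (A : comPzRingType) (f g : fps A) n :
  fps_mul f (fps_neg_var g) n = (-1) ^+ n * fps_mul g (fps_neg_var f) n.
Proof.
rewrite /fps_mul /fps_neg_var mulr_sumr (reindex_inj rev_ord_inj) /=.
apply: eq_bigr => k _; have le_kn : (k <= n)%N by rewrite -ltnS.
rewrite subSS subKn //.
have -> : (-1) ^+ n = (-1) ^+ (n - k) * (-1) ^+ k :> A.
  by rewrite -exprD subnK.
have sqr_sign m : (-1) ^+ m * (-1) ^+ m = 1 :> A.
  by rewrite -expr2 sqrr_sign.
transitivity ((-1) ^+ (n - k) * (-1) ^+ (n - k)
              * ((-1) ^+ k * f (n - k)%N * g k)); first by rewrite sqr_sign; ring.
by ring.
Qed.

Section QExponential.

Variables (F : fieldType) (q : F).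

Lemma qfact0 : qfact q 0 = 1.
Proof. by rewrite /qfact big_geq. Qed.

Lemma qfactS n : qfact q n.+1 = qfact q n * (1 - q ^+ n.+1).
Proof. by rewrite /qfact big_nat_recr. Qed.

Hypothesis q_neq_root1 : forall n, q ^+ n.+1 != 1.

Lemma one_sub_qpow_neq0 n : 1 - q ^+ n.+1 != 0.
Proof. by rewrite subr_eq0 eq_sym. Qed.

Lemma qfact_neq0 n : qfact q n != 0.
Proof.
elim: n => [|n IHn]; first by rewrite qfact0 oner_neq0.
by rewrite qfactS mulf_neq0 ?one_sub_qpow_neq0.
Qed.

(** The coefficientwise form of the q-difference equation
    [e_q(z,u) - e_q(qz,u) = z e_q(uz,u)]. *)
Lemma deformed_qexpS u n :
  (1 - q ^+ n.+1) * deformed_qexp q u n.+1 = u ^+ n * deformed_qexp q u n.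
Proof.
rewrite /deformed_qexp qfactS binS bin1 exprD.
have := qfact_neq0 n; have := one_sub_qpow_neq0 n.
move: (1 - _) (qfact q n) => a b a0 b0; field.
by rewrite a0 b0.
Qed.

(** The same equation for the product.  Splitting [1 - q^(n+1)] along [k] lets
    the difference equation of either factor act on its own summand; for the
    parameters [1] and [q] the resulting weights do not depend on [k]. *)
Lemma euler_product_rec n :
  let c := fps_mul (deformed_qexp q 1) (fps_neg_var (deformed_qexp q q)) in
  (1 - q ^+ n.+1) * c n.+1 = (1 - q ^+ n) * c n.
Proof.
rewrite /fps_mul /fps_neg_var /=.
set f := deformed_qexp q 1; set g := deformed_qexp q q.
transitivity
  (\sum_(k < n.+2) ((1 - q ^+ k) * f k) * ((-1) ^+ (n.+1 - k) * g (n.+1 - k)%N)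
   + \sum_(k < n.+2) q ^+ k * f k
       * ((-1) ^+ (n.+1 - k) * ((1 - q ^+ (n.+1 - k)) * g (n.+1 - k)%N))).
  rewrite -big_split mulr_sumr; apply: eq_bigr => k _ /=.
  have le_kn : (k <= n.+1)%N by rewrite -ltnS.
  by rewrite -{1}(subnKC le_kn) exprD; ring.
rewrite big_ord_recl /= expr0 subrr !mul0r add0r.
rewrite [X in _ + X]big_ord_recr /= subnn expr0 subrr !(mul0r, mulr0) addr0.
rewrite -big_split mulr_sumr; apply: eq_bigr => k _ /=.
have le_kn : (k <= n)%N by rewrite -ltnS.
rewrite /bump /= add1n subSS deformed_qexpS expr1n mul1r subSn //.
rewrite deformed_qexpS exprS -/f -/g.
have -> : q ^+ n = q ^+ k * q ^+ (n - k) by rewrite -exprD subnKC.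
by ring.
Qed.

Lemma euler_product :
  fps_mul (deformed_qexp q 1) (fps_neg_var (deformed_qexp q q)) =1 fps_one F.
Proof.
set c := fps_mul _ _.
have c_const n : (1 - q ^+ n) * c n = 0.
  elim: n => [|n IHn]; first by rewrite expr0 subrr mul0r.
  by rewrite /c euler_product_rec.
case=> [|n].
  rewrite /c /fps_mul /fps_neg_var /deformed_qexp big_ord1 /= qfact0.
  by rewrite !expr0 !divr1 !mulr1.
apply/eqP; have /eqP := c_const n.+1.
by rewrite mulf_eq0 (negPf (one_sub_qpow_neq0 n)).
Qed.

Lemma euler_product_sym :
  fps_mul (deformed_qexp q q) (fps_neg_var (deformed_qexp q 1)) =1 fps_one F.
Proof.
move=> n; rewrite fps_mul_neg_varC euler_product /fps_one.
by case: n => [|n]; rewrite ?expr0 ?mulr1 ?mulr0.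
Qed.

Section LowDegrees.

Variables u v : F.

Let c := fps_mul (deformed_qexp q u) (fps_neg_var (deformed_qexp q v)).

Let q1 : 1 - q != 0. Proof. exact: (one_sub_qpow_neq0 0). Qed.
Let q2 : 1 - q ^+ 2 != 0. Proof. exact: (one_sub_qpow_neq0 1). Qed.
Let q3 : 1 - q ^+ 3 != 0. Proof. exact: (one_sub_qpow_neq0 2). Qed.
Let q4 : 1 - q ^+ 4 != 0. Proof. exact: (one_sub_qpow_neq0 3). Qed.

(** Multiplied by [(q; q)_n], the summands of [c_n] acquire Gaussian binomials
    as coefficients, so that the vanishing of [c_n] becomes a polynomial
    equation in [u] and [v]; for odd [n] it is antisymmetric, whence the factor
    [u - v] in degree 3. *)
Lemma qfact_mul_coef2 : qfact q 2 * c 2 = u + v - (1 + q).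
Proof.
rewrite /c /fps_mul /fps_neg_var /deformed_qexp !big_ord_recl big_ord0 /=.
rewrite /bump /= !qfactS qfact0 !subn0 !expr1.
by field; rewrite ?oner_neq0 ?q1 ?q2 ?q3 ?q4.
Qed.

Lemma qfact_mul_coef3 :
  qfact q 3 * c 3 = (u - v) * (u ^+ 2 + u * v + v ^+ 2 - (1 + q + q ^+ 2)).
Proof.
rewrite /c /fps_mul /fps_neg_var /deformed_qexp !big_ord_recl big_ord0 /=.
rewrite /bump /= !qfactS qfact0 !subn0 !expr1.
by field; rewrite ?oner_neq0 ?q1 ?q2 ?q3 ?q4.
Qed.

Lemma qfact_mul_coef4 :
  qfact q 4 * c 4 = u ^+ 6 + v ^+ 6 - (1 + q) * (1 + q ^+ 2) * (u ^+ 3 + v ^+ 3)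
                    + (1 + q ^+ 2) * (1 + q + q ^+ 2) * (u * v).
Proof.
rewrite /c /fps_mul /fps_neg_var /deformed_qexp !big_ord_recl big_ord0 /=.
rewrite /bump /= !qfactS qfact0 !subn0 !expr1.
by field; rewrite ?oner_neq0 ?q1 ?q2 ?q3 ?q4.
Qed.

Lemma low_degrees_determine :
  c 2 = 0 -> c 3 = 0 -> c 4 = 0 -> (u, v) = (1, q) \/ (u, v) = (q, 1).
Proof.
move=> c2 c3 c4.
have sum_uv : v = 1 + q - u.
  by apply/eqP; rewrite -subr_eq0 -[X in _ == X](mulr0 (qfact q 2)) -c2
    qfact_mul_coef2; apply/eqP; ring.
have /eqP := qfact_mul_coef3; rewrite c3 mulr0 eq_sym mulf_eq0 => /orP[].
  rewrite subr_eq0 => /eqP eq_uv.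
  have q_u : q = u + u - 1 by rewrite {2}eq_uv sum_uv; ring.
  have u0 : u != 0.
    apply: contraNneq (q_neq_root1 1) => u_eq0.
    by rewrite q_u u_eq0 addr0 sub0r sqrrN expr1n.
  (* Under [2 u = 1 + q], [(q; q)_4 c_4] is [u^2 (1 - q)^4 / 8];
     multiplying by 8 keeps the argument free of the characteristic. *)
  have : u ^+ 2 * (1 - q) ^+ 4 = 8%:R * (qfact q 4 * c 4).
    by rewrite qfact_mul_coef4 -eq_uv q_u; ring.
  rewrite c4 !mulr0 => /eqP.
  by rewrite mulf_eq0 !expf_eq0 /= (negPf u0) (negPf q1).
move=> uv_q.
have : (u - 1) * (u - q) == 0.
  by rewrite -(eqP uv_q) sum_uv; apply/eqP; ring.
rewrite mulf_eq0 !subr_eq0 => /orP[] /eqP u_eq; [left | right];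
  by rewrite sum_uv u_eq; congr (_, _); ring.
Qed.

End LowDegrees.

End QExponential.

Theorem theorem1 (R : realType) (q : R) (u v : R[i]) (q_gt0 : 0 < q) (q_lt1 : q < 1) :
  fps_mul (deformed_qexp q%:C u) (fps_neg_var (deformed_qexp q%:C v))
    =1 fps_one R[i]
  <-> (u, v) = (1, q%:C) \/ (u, v) = (q%:C, 1).
Proof.
have q_neq_root1 n : q%:C ^+ n.+1 != 1 :> R[i].
  rewrite -rmorphXn -(rmorph1 (real_complex R)) (inj_eq (@complexI R)).
  by rewrite lt_eqF // exprn_ilt1 // ltW.
split=> [prod1 | [] [-> ->]].
- by apply: (low_degrees_determine q_neq_root1); rewrite prod1.
- exact: euler_product.
- exact: euler_product_sym.
Qed.
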